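(* Let $M(|\psi\rangle)$ be a measure of imaginarity of pure states $|\psi\rangle$ of a $d$-dimensional Hilbert space $\mathcal{H}$ with fixed orthonormal basis. For a density operator $\rho$ on $\mathcal{H}$ define the convex roof extension $$M(\rho)=\min_{\{p_i,|\psi_i\rangle\}}\sum_i p_iM(|\psi_i\rangle),$$ where the minimum is over all decompositions $\rho=\sum_ip_i|\psi_i\rangle\langle\psi_i|$ with $\{p_i\}$ a probability distribution and $|\psi_i\rangle$ pure states. If $M(\rho)$ is a convex function of $\rho$, then $M(\rho)$ is a measure of imaginarity of mixed states.
   Context: Fix an orthonormal basis $\{|j\rangle\}_{j=0}^{d-1}$ of $\mathcal{H}$. A density operator is a real state if all its matrix elements in this basis are real; $\mathcal{F}$ is the set of real states. A free operation (real operation) is a CPTP map $\varepsilon(\rho)=\sum_jK_j\rho K_j^\dagger$, $\sum_jK_j^\dagger K_j=\mathbb{I}$, with all $\langle i|K_j|l\rangle\in\mathbb{R}$. A measure of imaginarity is a function $M:\mathcal{D}(\mathcal{H})\to[0,\infty)$ on density operators such that (1) $M(\rho)=0$ if and only if $\rho\in\mathcal{F}$; (2) $M(\varepsilon(\rho))\le M(\rho)$ for every free operation $\varepsilon$. A measure of imaginarity of pure states is a function $M$ from pure states to $[0,\infty)$ satisfying these conditions on pure states: $M(|\psi\rangle)=0$ if and only if $|\psi\rangle\langle\psi|\in\mathcal{F}$, and $M(|\phi\rangle)\le M(|\psi\rangle)$ whenever $|\phi\rangle\langle\phi|=\varepsilon(|\psi\rangle\langle\psi|)$ for a free operation $\varepsilon$.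 *)

(* Defs.v *)
From mathcomp Require Import all_boot all_order all_algebra.
From mathcomp Require Import boolp classical_sets reals complex.

Set Implicit Arguments.
Unset Strict Implicit.
Unset Printing Implicit Defensive.

Import Order.TTheory GRing.Theory Num.Theory.
Local Open Scope ring_scope.
Local Open Scope complex_scope.
Local Open Scope sesquilinear_scope.

Section Imaginarity.
Context {R : realType} {d : nat}.
Local Notation C := R[i].

(* The Hilbert space is C^d with its standard basis as the fixed orthonormal
   basis; kets are column vectors and A ^t* is the adjoint of A. *)

Definition pure_state (psi : 'cV[C]_d) : Prop := psi ^t* *m psi = 1%:M.

Definition proj (psi : 'cV[C]_d) : 'M[C]_d := psi *m psi ^t*.

(* In R[i], 0 <= z means that z is real and nonnegative. *)
Definition density (rho : 'M[C]_d) : Prop :=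
  [/\ rho \is hermsymmx,
      forall v : 'cV[C]_d, 0 <= (v ^t* *m rho *m v) 0 0
    & \tr rho = 1].

Definition real_state (rho : 'M[C]_d) : Prop :=
  density rho /\ rho \is a realmx.

Definition real_operation (eps : 'M[C]_d -> 'M[C]_d) : Prop :=
  exists (n : nat) (K : 'I_n -> 'M[C]_d),
    [/\ forall j, K j \is a realmx,
        \sum_j (K j) ^t* *m K j = 1%:M
      & forall rho, eps rho = \sum_j K j *m rho *m (K j) ^t*].

(* Only the values on density operators matter. *)
Definition imaginarity_measure (M : 'M[C]_d -> R) : Prop :=
  [/\ forall rho, density rho -> 0 <= M rho,
      forall rho, density rho -> (M rho = 0 <-> real_state rho)
    & forall eps rho, real_operation eps -> density rho ->
        M (eps rho) <= M rho].

(* Only the values on unit vectors matter.  Taking eps to be the identity in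
   the last clause shows that M does not depend on the global phase. *)
Definition pure_imaginarity_measure (M : 'cV[C]_d -> R) : Prop :=
  [/\ forall psi, pure_state psi -> 0 <= M psi,
      forall psi, pure_state psi -> (M psi = 0 <-> real_state (proj psi))
    & forall eps psi phi, real_operation eps ->
        pure_state psi -> pure_state phi ->
        proj phi = eps (proj psi) -> M phi <= M psi].

Definition pure_decomposition (rho : 'M[C]_d) (n : nat)
    (p : 'I_n -> R) (psi : 'I_n -> 'cV[C]_d) : Prop :=
  [/\ forall i, 0 <= p i,
      \sum_i p i = 1,
      forall i, pure_state (psi i)
    & rho = \sum_i (p i)%:C *: proj (psi i)].

Definition roof_values (M : 'cV[C]_d -> R) (rho : 'M[C]_d) : set R :=
  [set x | exists (n : nat) (p : 'I_n -> R) (psi : 'I_n -> 'cV[C]_d),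
     pure_decomposition rho p psi /\ x = \sum_i p i * M (psi i)]%classic.

(* The minimum over the decompositions, taken as an infimum so that it is
   defined for every M; see convex_roof_min.  On density operators and for
   M nonnegative on unit vectors, roof_values M rho is nonempty and bounded
   below by 0. *)
Definition convex_roof (M : 'cV[C]_d -> R) (rho : 'M[C]_d) : R :=
  inf (roof_values M rho).

Lemma convex_roof_min (M : 'cV[C]_d -> R) (rho : 'M[C]_d) (m : R) :
  roof_values M rho m -> lbound (roof_values M rho) m ->
  convex_roof M rho = m.
Proof.
move=> vm lbm; apply/eqP; rewrite eq_le; apply/andP; split.
  by apply: ge_inf => //; exists m.
by apply: lb_le_inf => //; exists m.
Qed.

Definition convex_on_states (f : 'M[C]_d -> R) : Prop :=
  forall (rho sigma : 'M[C]_d) (t : R), density rho -> density sigma ->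
    0 <= t <= 1 ->
    f (t%:C *: rho + (1 - t)%:C *: sigma) <= t * f rho + (1 - t) * f sigma.

End Imaginarity.

(* Main.v *)
Require Import Defs.
From mathcomp Require Import all_boot all_order all_algebra.
From mathcomp Require Import boolp classical_sets reals complex.
From mathcomp Require Import ring lra.

(** Write [r psi = |psi^T psi|] ([reality] below).  Choosing the global phase so that
    [psi = a + i b] with [a], [b] real and orthogonal and [|a|^2 - |b|^2 = r psi], three
    real Kraus operators map [psi] to any [phi] with [r psi <= r phi]; hence [M] is a
    nonincreasing function of [r].

    Monotonicity of the roof: let [w_j = K_j psi] be the outputs of a real operation on
    [psi], with the phase chosen so that [psi^T psi >= 0].  The real quadratic form
    [q w = Re (w^T w) - r psi |w|^2] sums to zero over the [w_j].  Real rotations of pairs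
    of these vectors preserve both the mixture [sum_j w_j w_j^+] and [sum_j q w_j], and can
    be used to make every [q w_j] nonnegative; then every (normalized) [w_j] has [r w_j >= r psi], so
    [M w_j <= M psi].

    Faithfulness of the infimum: [|Im (psi_k conj(psi_l))|^2 <= (1 - r psi) / 2] for [k <> l],
    so a pure state with a large imaginary entry has [r] below that of some fixed non-real
    [phi], hence [M] above [M phi > 0].  This bounds every value of the roof from below
    whenever [rho] has a non-real entry, even if the infimum is not attained. *)

Set Implicit Arguments.
Unset Strict Implicit.
Unset Printing Implicit Defensive.

Import Order.TTheory GRing.Theory Num.Theory.
Local Open Scope ring_scope.
Local Open Scope complex_scope.
Local Open Scope sesquilinear_scope.

Local Notation Re := complex.Re.
Local Notation Im := complex.Im.

(** * Real and imaginary parts of complex vectors; the forms [sqn] and [bil] *)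

Section ComplexVectors.
Context {R : realType} {d : nat}.
Local Notation C := R[i].
Implicit Types (x y z : 'cV[R]_d) (v w : 'cV[C]_d).

Lemma complex_ext (z t : C) : Re z = Re t -> Im z = Im t -> z = t.
Proof. by case: z t => [a b] [a' b'] /= -> ->. Qed.

Lemma Re_add (z t : C) : Re (z + t) = Re z + Re t.
Proof. by case: z t => [a b] [a' b']. Qed.

Lemma Im_add (z t : C) : Im (z + t) = Im z + Im t.
Proof. by case: z t => [a b] [a' b']. Qed.

Lemma Re_mul (z t : C) : Re (z * t) = Re z * Re t - Im z * Im t.
Proof. by case: z t => [a b] [a' b']. Qed.

Lemma Im_mul (z t : C) : Im (z * t) = Re z * Im t + Im z * Re t.
Proof. by case: z t => [a b] [a' b']. Qed.

Lemma Re_conj (z : C) : Re (Num.conj z) = Re z.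
Proof. by case: z. Qed.

Lemma Im_conj (z : C) : Im (Num.conj z) = - Im z.
Proof. by case: z. Qed.

Lemma Re_sum I (s : seq I) (P : pred I) (F : I -> C) :
  Re (\sum_(i <- s | P i) F i) = \sum_(i <- s | P i) Re (F i).
Proof. exact: (big_morph _ Re_add). Qed.

Lemma Im_sum I (s : seq I) (P : pred I) (F : I -> C) :
  Im (\sum_(i <- s | P i) F i) = \sum_(i <- s | P i) Im (F i).
Proof. exact: (big_morph _ Im_add). Qed.

Definition ReImE := (Re_add, Im_add, Re_mul, Im_mul, Re_conj, Im_conj).

Lemma unit_phase (z : C) : exists2 u : C, u * Num.conj u = 1 & u ^+ 2 * z = `|z|.
Proof.
have [->|z0] := eqVneq z 0; first by exists 1; rewrite ?conjC1 ?mulr1 ?mulr0 ?normr0.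
have nz0 : `|z| != 0 by rewrite normr_eq0.
exists (sqrtC (Num.conj z / `|z|)); last first.
  by rewrite sqrtCK mulrAC [_ * z]mulrC -normCK expr2 mulfK.
apply/eqP; rewrite -normCK -normrX sqrtCK normrM normfV normr_id norm_conjC.
by rewrite divff.
Qed.

Definition dot x y : R := (x^T *m y) 0 0.

Lemma dotE x y : dot x y = \sum_i x i 0 * y i 0.
Proof. by rewrite /dot mxE; apply: eq_bigr => i _; rewrite mxE. Qed.

Lemma dotC x y : dot x y = dot y x.
Proof. by rewrite !dotE; apply: eq_bigr => i _; rewrite mulrC. Qed.

Lemma trmx_mul_dot x y : x^T *m y = (dot x y)%:M.
Proof. exact: mx11_scalar. Qed.

Lemma outer_mul x y z : x *m y^T *m z = dot y z *: x.
Proof. by rewrite -mulmxA trmx_mul_dot mul_mx_scalar. Qed.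

Lemma dot_ge0 x : 0 <= dot x x.
Proof. by rewrite dotE sumr_ge0 // => i _; rewrite -expr2 sqr_ge0. Qed.

Lemma dot_eq0 x : dot x x = 0 -> x = 0.
Proof.
rewrite dotE => /eqP; rewrite psumr_eq0 => [/allP x0|i _]; last first.
  by rewrite -expr2 sqr_ge0.
apply/matrixP => i j; rewrite ord1 mxE.
by move: (x0 i (mem_index_enum _)); rewrite /= mulf_eq0 orbb => /eqP.
Qed.

Definition toC m n (A : 'M[R]_(m, n)) : 'M[C]_(m, n) := map_mx (real_complex R) A.
Definition vec x y : 'cV[C]_d := toC x + 'i *: toC y.
Definition re v : 'cV[R]_d := map_mx (@complex.Re R) v.
Definition im v : 'cV[R]_d := map_mx (@complex.Im R) v.

Lemma vecE x y i : vec x y i 0 = x i 0 +i* y i 0.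
Proof. by rewrite !mxE; apply: complex_ext; rewrite !ReImE /=; ring. Qed.

Lemma vec_re_im v : vec (re v) (im v) = v.
Proof. by apply/matrixP => i j; rewrite ord1 vecE !mxE; case: (v i 0). Qed.

Lemma re_vec x y : re (vec x y) = x.
Proof. by apply/matrixP => i j; rewrite ord1 mxE vecE. Qed.

Lemma im_vec x y : im (vec x y) = y.
Proof. by apply/matrixP => i j; rewrite ord1 mxE vecE. Qed.

Lemma toC_realmx m n (A : 'M[R]_(m, n)) : toC A \is a realmx.
Proof. by apply/mxOverP => i j; rewrite mxE; apply/complex_realP; exists (A i j). Qed.

Lemma realmx_toC m n (A : 'M[C]_(m, n)) : A \is a realmx -> exists B, A = toC B.
Proof.
move=> /mxOverP Ar; exists (map_mx (@complex.Re R) A); apply/matrixP => i j.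
by rewrite !mxE RRe_real.
Qed.

Lemma toC_adj m n (A : 'M[R]_(m, n)) : (toC A) ^t* = toC A^T.
Proof. by apply/matrixP => i j; rewrite !mxE; apply: complex_ext => /=; rewrite ?oppr0. Qed.

Lemma toC_mul m n p (A : 'M[R]_(m, n)) (B : 'M[R]_(n, p)) :
  toC (A *m B) = toC A *m toC B.
Proof. exact: map_mxM. Qed.

Lemma toC1 n : toC 1%:M = 1%:M :> 'M[C]_n.
Proof. exact: map_mx1. Qed.

Lemma toC_inj m n : injective (@toC m n).
Proof.
move=> A B /matrixP AB; apply/matrixP => i j.
by have := AB i j; rewrite !mxE; apply: complexI.
Qed.

Lemma toC_sum I (s : seq I) m n (A : I -> 'M[R]_(m, n)) :
  toC (\sum_(i <- s) A i) = \sum_(i <- s) toC (A i).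
Proof.
apply/matrixP => i j; rewrite mxE !summxE rmorph_sum.
by apply: eq_bigr => k _; rewrite mxE.
Qed.

Lemma toC_mulmx (A : 'M[R]_d) x y : toC A *m vec x y = vec (A *m x) (A *m y).
Proof. by rewrite /vec mulmxDr -scalemxAr -!map_mxM. Qed.

Definition sqn v : R := dot (re v) (re v) + dot (im v) (im v).
(** This is [v^T v], without conjugation: a global phase [u] multiplies it by [u^2], so only its
    modulus is a property of the state. *)
Definition bil v : C := \sum_i v i 0 ^+ 2.

Lemma sqn_ge0 v : 0 <= sqn v.
Proof. by rewrite addr_ge0 ?dot_ge0. Qed.

Lemma sqn_eq0 v : sqn v = 0 -> v = 0.
Proof.
move=> /eqP; rewrite paddr_eq0 ?dot_ge0 // => /andP[/eqP/dot_eq0 re0 /eqP/dot_eq0 im0].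
by rewrite -(vec_re_im v) re0 im0; apply/matrixP => i j; rewrite ord1 vecE !mxE.
Qed.

Lemma adj_mul v : v ^t* *m v = ((sqn v)%:C)%:M.
Proof.
rewrite [LHS]mx11_scalar; congr (_%:M); rewrite mxE /sqn !dotE -big_split /=.
apply: complex_ext; rewrite ?Re_sum ?Im_sum /=.
  by apply: eq_bigr => i _; rewrite !mxE !ReImE; ring.
by apply: big1 => i _; rewrite !mxE !ReImE; ring.
Qed.

Lemma pure_stateE v : pure_state v <-> sqn v = 1.
Proof.
rewrite /pure_state adj_mul; split => [/matrixP /(_ 0 0)|->//].
by rewrite !mxE !mulr1n => -[].
Qed.

Lemma bilE v : bil v = (dot (re v) (re v) - dot (im v) (im v))
                           +i* (2 * dot (re v) (im v)).
Proof.
rewrite !dotE mulr_sumr -sumrB; apply: complex_ext; rewrite ?Re_sum ?Im_sum /=.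
  by apply: eq_bigr => i _; rewrite !mxE expr2 !ReImE; ring.
by apply: eq_bigr => i _; rewrite !mxE expr2 !ReImE; ring.
Qed.

Lemma bilZ (u : C) v : bil (u *: v) = u ^+ 2 * bil v.
Proof. by rewrite mulr_sumr; apply: eq_bigr => i _; rewrite mxE exprMn. Qed.

Lemma projE v i j : proj v i j = v i 0 * Num.conj (v j 0).
Proof. by rewrite mxE big_ord1 !mxE. Qed.

Lemma projZ (u : C) v : proj (u *: v) = (u * Num.conj u) *: proj v.
Proof. by apply/matrixP => i j; rewrite [RHS]mxE !projE !mxE rmorphM /=; ring. Qed.

Lemma sqn_trace v : \tr (proj v) = (sqn v)%:C.
Proof. by rewrite mxtrace_mulC adj_mul mxtrace_scalar mulr1n. Qed.

Lemma sqnZ (u : C) v : sqn (u *: v) = Re (u * Num.conj u) * sqn v.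
Proof.
rewrite /sqn !dotE mulrDr !mulr_sumr -!big_split /=.
by apply: eq_bigr => i _; rewrite !mxE !ReImE; ring.
Qed.

(** The imaginary part of [bil] is twice the dot product of the real and imaginary parts, so a phase
    that makes [bil] real makes these two orthogonal. *)
Lemma align v : exists u : C,
  [/\ u * Num.conj u = 1, bil (u *: v) = `|bil v| & dot (re (u *: v)) (im (u *: v)) = 0].
Proof.
have [u u1 uz] := unit_phase (bil v); exists u; rewrite bilZ; split => //.
have : Im (bil (u *: v)) = 0 by rewrite bilZ uz normc_def.
by rewrite bilE /=; lra.
Qed.

Lemma proj_mul (K : 'M[C]_d) v : K *m proj v *m K ^t* = proj (K *m v).
Proof. by rewrite /proj trmx_mul map_mxM !mulmxA. Qed.

Lemma proj0 : proj (0 : 'cV[C]_d) = 0.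
Proof. by rewrite /proj mul0mx. Qed.

End ComplexVectors.

(** * Rotations of pairs in a mixture, and the sign of a quadratic form *)

Section Pooling.
Context {R : realType} {d : nat}.
Local Notation C := R[i].
Implicit Types (v w : 'cV[C]_d) (s t : seq 'cV[C]_d).
Variables (al be : R).

Let q v := al * dot (re v) (re v) + be * dot (im v) (im v).
Let B v w := al * dot (re v) (re w) + be * dot (im v) (im w).

Let q_comb (a b : R) v w : q (a%:C *: v + b%:C *: w) =
  a ^+ 2 * q v + 2 * a * b * B v w + b ^+ 2 * q w.
Proof.
rewrite /q /B !dotE !mulr_sumr -!big_split /= !mulr_sumr -!big_split /=.
by apply: eq_bigr => i _; rewrite !mxE !ReImE /=; ring.
Qed.

(** The rotation has cosine [a] and sine [b]; the cross terms of the two outer products cancel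
    because the coefficients are real. *)
Lemma proj_rotate (a b : R) v w : a ^+ 2 + b ^+ 2 = 1 ->
  proj (a%:C *: v + b%:C *: w) + proj ((- b)%:C *: v + a%:C *: w) = proj v + proj w.
Proof.
move=> ab; have {ab} b2 : b ^+ 2 = 1 - a ^+ 2 by lra.
have combE (x y : R) k : (x%:C *: v + y%:C *: w) k 0 = x%:C * v k 0 + y%:C * w k 0.
  by rewrite !mxE.
(* Unification with [proj (_ + _)] diverges unless the sums are abstracted. *)
move: (combE a b) (combE (- b) a); move: (_ + _) => x; move: (_ + _) => y xE yE.
apply/matrixP => i j; rewrite [LHS]mxE [RHS]mxE !projE !xE !yE.
by apply: complex_ext; rewrite !ReImE /=; ring: b2.
Qed.

(** As a quadratic in [t], [q (v + t w)] has leading coefficient [q w > 0] and constant term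
    [q v < 0], hence a real root. Scaling [(1, t)] to unit length gives [a] and [b]. *)
Let q_root v w : q v < 0 -> 0 < q w ->
  exists a b : R, a ^+ 2 + b ^+ 2 = 1 /\ q (a%:C *: v + b%:C *: w) = 0.
Proof.
move=> qv qw; have D0 : 0 <= B v w ^+ 2 - q v * q w.
  by have := sqr_ge0 (B v w); nra.
pose t := (- B v w + Num.sqrt (B v w ^+ 2 - q v * q w)) / q w.
have troot : q v + 2 * t * B v w + t ^+ 2 * q w = 0.
  have qw0 : q w != 0 by rewrite gt_eqF.
  have := sqr_sqrtr D0; rewrite /t; move: (Num.sqrt _) => D eD.
  have -> : q v = (B v w ^+ 2 - D ^+ 2) / q w by rewrite eD; field.
  by field.
have t1 : 0 < 1 + t ^+ 2 by have := sqr_ge0 t; lra.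
pose c := Num.sqrt (1 + t ^+ 2)^-1.
have c2 : c ^+ 2 = (1 + t ^+ 2)^-1 by rewrite sqr_sqrtr // invr_ge0 ltW.
exists c, (c * t); split.
  by rewrite exprMn c2; field; rewrite gt_eqF.
rewrite q_comb; transitivity (c ^+ 2 * (q v + 2 * t * B v w + t ^+ 2 * q w)); first ring.
by rewrite troot mulr0.
Qed.

(* Each step rotates a vector with [q < 0] against one with [q > 0] so that the first gets
   [q = 0], then sets it aside. *)
Lemma pool s : 0 <= \sum_(v <- s) q v ->
  exists t, \sum_(v <- t) proj v = \sum_(v <- s) proj v
            /\ forall v, v \in t -> 0 <= q v.
Proof.
have [n] := ubnP (size s); elim: n s => // n IHn s szs qs.
case: (altP (@allP _ (fun v => 0 <= q v) s)) => [pos|/allPn[v vs]]; first by exists s.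
rewrite -ltNge => qv.
pose s1 := rem v s; have ps : perm_eq s (v :: s1) by apply: perm_to_rem.
have qs1 : 0 < \sum_(w <- s1) q w by move: qs; rewrite (perm_big _ ps) big_cons /=; lra.
have [w ws qw] : exists2 w, w \in s1 & 0 < q w.
  apply/hasP; apply: contraTT qs1 => /hasPn neg; rewrite -leNgt big_seq.
  by apply: sumr_le0 => w /neg; rewrite -leNgt.
pose s2 := rem w s1; have ps1 : perm_eq s1 (w :: s2) by apply: perm_to_rem.
have ps2 : perm_eq s (v :: w :: s2).
  by rewrite (perm_trans ps) // perm_cons.
have [a [b [ab q0]]] := q_root qv qw.
set v' := _ + _ in q0; pose w' := (- b)%:C *: v + a%:C *: w.
(* A rotation preserves the sum of the two values of [q]. Since [q v' = 0], [w'] carries all of it,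
   and the shorter list keeps the total. *)
have qw' : q w' = q v + q w.
  transitivity ((a ^+ 2 + b ^+ 2) * (q v + q w) - q v').
    by rewrite /v' /w' !q_comb; ring.
  by rewrite ab q0; ring.
have [|| t [tE tq]] := IHn (w' :: s2).
- by move: szs; rewrite (perm_size ps2) /=.
- by move: qs; rewrite (perm_big _ ps2) !big_cons /= qw' addrA.
exists (v' :: t); split; last first.
  by move=> x; rewrite inE => /orP[/eqP->|/tq //]; rewrite q0.
by rewrite (perm_big _ ps2) !big_cons /= tE big_cons !addrA proj_rotate.
Qed.

End Pooling.

(** * Real operations carrying one aligned pure state to another *)

Section Transport.
Context {R : realType} {d : nat}.
Local Notation C := R[i].
Implicit Types (x y z a b : 'cV[R]_d) (v w : 'cV[C]_d).

Lemma density_proj v : pure_state v -> density (proj v).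
Proof.
move=> pv; split.
- apply/is_hermitianmxP; rewrite expr0 scale1r.
  by rewrite /proj trmx_mul map_mxM map_trmx trmxK map_mxCK.
- move=> w; rewrite /proj mulmxA -mulmxA.
  have -> : v ^t* *m w = (w ^t* *m v) ^t* by rewrite trmx_mul map_mxM trmxCK.
  by rewrite mxE big_ord1 !mxE -normCK exprn_ge0.
- by rewrite sqn_trace; move/pure_stateE: pv => ->.
Qed.

Lemma outer_outer x y z a : x *m y^T *m (z *m a^T) = dot y z *: (x *m a^T).
Proof. by rewrite mulmxA outer_mul -scalemxAl. Qed.

Lemma tr_outer (c : R) x y : (c *: (x *m y^T))^T = c *: (y *m x^T).
Proof. by apply/matrixP => i j; rewrite !mxE !big_ord1 !mxE [y _ _ * _]mulrC. Qed.

Lemma tr_outer2 (c c' : R) x y x' y' :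
  (c *: (x *m y^T) + c' *: (x' *m y'^T))^T = c *: (y *m x^T) + c' *: (y' *m x'^T).
Proof. by rewrite -[in RHS]tr_outer -(tr_outer c' x'); apply/matrixP => i j; rewrite !mxE. Qed.

Lemma complement_projection (P Q : 'M[R]_d) : P^T = P -> Q^T = Q ->
  P *m P = P -> Q *m Q = Q -> P *m Q = 0 -> Q *m P = 0 ->
  (1%:M - P - Q)^T *m (1%:M - P - Q) = 1%:M - P - Q.
Proof.
move=> PT QT PP QQ PQ QP; have -> : (1%:M - P - Q)^T = 1%:M - P - Q.
  by rewrite -[in RHS]PT -[in RHS]QT; apply/matrixP => i j; rewrite !mxE eq_sym.
rewrite !mulmxBl !mulmxBr !mul1mx !mulmx1 PP QQ PQ QP.
by rewrite !(subrr, subr0).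
Qed.

(* [k1] maps [a + i b] to [a' + i b'], [k2] maps it to [i (a' + i b')], and the projection
   [1 - P - Q] kills it. *)
Section Kraus.
Variables (a b a' b' : 'cV[R]_d).
Hypotheses (ab : dot a b = 0) (ab' : dot a' b' = 0).
Hypotheses (a0 : dot a a != 0) (b0 : dot b b != 0).

Let P : 'M[R]_d := (dot a a)^-1 *: (a *m a^T).
Let Q : 'M[R]_d := (dot b b)^-1 *: (b *m b^T).
Let k1 : 'M[R]_d := (dot a a)^-1 *: (a' *m a^T) + (dot b b)^-1 *: (b' *m b^T).
Let k2 : 'M[R]_d := (dot b b)^-1 *: (a' *m b^T) + (- (dot a a)^-1) *: (b' *m a^T).

Let k1k1 : k1^T *m k1 = (dot a' a' / dot a a) *: P + (dot b' b' / dot b b) *: Q.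
Proof.
rewrite {1}/k1 tr_outer2 /k1 /P /Q.
rewrite mulmxDl !mulmxDr -!scalemxAl -!scalemxAr !outer_outer ab' (dotC b') ab'.
by rewrite !scale0r !scaler0 addr0 add0r !scalerA; congr (_ *: _ + _ *: _); field.
Qed.

Let k2k2 : k2^T *m k2 = (dot b' b' / dot a a) *: P + (dot a' a' / dot b b) *: Q.
Proof.
rewrite {1}/k2 tr_outer2 /k2 /P /Q.
rewrite mulmxDl !mulmxDr -!scalemxAl -!scalemxAr !outer_outer ab' (dotC b') ab'.
rewrite !scale0r !scaler0 addr0 add0r !scalerA addrC.
by congr (_ *: _ + _ *: _); field.
Qed.

Let k3k3 : (1%:M - P - Q)^T *m (1%:M - P - Q) = 1%:M - P - Q.
Proof.
have PT : P^T = P by exact: tr_outer.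
have QT : Q^T = Q by exact: tr_outer.
have PP : P *m P = P.
  by rewrite -scalemxAl -scalemxAr outer_outer !scalerA; congr (_ *: _); field.
have QQ : Q *m Q = Q.
  by rewrite -scalemxAl -scalemxAr outer_outer !scalerA; congr (_ *: _); field.
have PQ : P *m Q = 0 by rewrite -scalemxAl -scalemxAr outer_outer ab scale0r !scaler0.
have QP : Q *m P = 0 by rewrite -scalemxAl -scalemxAr outer_outer dotC ab scale0r !scaler0.
exact: complement_projection.
Qed.

(** Use [k1] with weight [t] and [k2] with weight [1 - t]. The two equations say that [P] and [Q]
    then get coefficient 1 in the sum of the [K^T K]; the third operator supplies [1 - P - Q]. *)
Lemma kraus_exists (t : R) : 0 <= t <= 1 ->
  t * dot a' a' + (1 - t) * dot b' b' = dot a a ->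
  t * dot b' b' + (1 - t) * dot a' a' = dot b b ->
  exists eps : 'M[C]_d -> 'M[C]_d, real_operation eps
    /\ eps (proj (vec a b)) = proj (vec a' b').
Proof.
move=> /andP[t0 t1] eA eB.
pose c1 : R := Num.sqrt t; pose c2 : R := Num.sqrt (1 - t).
have c1t : c1 * c1 = t by rewrite -expr2 sqr_sqrtr.
have c2t : c2 * c2 = 1 - t by rewrite -expr2 sqr_sqrtr // subr_ge0.
pose ks : seq 'M[R]_d := [:: c1 *: k1; c2 *: k2; 1%:M - P - Q].
exists (fun rho => \sum_(i < 3) toC ks`_i *m rho *m (toC ks`_i) ^t*); split.
  exists 3%N, (fun i : 'I_3 => toC ks`_i); split => // [j|]; first exact: toC_realmx.
  have sumE : \sum_(i < 3) (ks`_i)^T *m ks`_i = 1%:M.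
    rewrite !big_ord_recl big_ord0 addr0 /=.
    have scE (c : R) (k : 'M[R]_d) : (c *: k)^T *m (c *: k) = (c * c) *: (k^T *m k).
      by rewrite [(c *: k)^T]linearZ /= -scalemxAl -scalemxAr scalerA.
    rewrite !scE c1t c2t k1k1 k2k2 k3k3; clearbody P Q.
    apply/matrixP => i j; rewrite !mxE; move: (P i j) (Q i j) (_ *+ _) => p q e.
    transitivity (e - p - q + (t * dot a' a' + (1 - t) * dot b' b') / dot a a * p
                    + (t * dot b' b' + (1 - t) * dot a' a') / dot b b * q); first ring.
    by rewrite eA eB !divff //; ring.
  transitivity (toC (\sum_(i < 3) (ks`_i)^T *m ks`_i)); last by rewrite sumE toC1.
  by rewrite toC_sum; apply: eq_bigr => i _; rewrite toC_adj -toC_mul.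
have ka : k1 *m a = a'.
  rewrite mulmxDl -!scalemxAl !outer_mul (dotC b) ab scale0r scaler0 addr0.
  by rewrite scalerA mulVf ?scale1r.
have kb : k1 *m b = b'.
  by rewrite mulmxDl -!scalemxAl !outer_mul ab scale0r scaler0 add0r scalerA mulVf ?scale1r.
have la : k2 *m a = - b'.
  rewrite mulmxDl -!scalemxAl !outer_mul (dotC b) ab scale0r scaler0 add0r.
  by rewrite scalerA mulNr mulVf ?scaleN1r.
have lb : k2 *m b = a'.
  by rewrite mulmxDl -!scalemxAl !outer_mul ab scale0r scaler0 addr0 scalerA mulVf ?scale1r.
have ma : (1%:M - P - Q) *m a = 0.
  rewrite !mulmxBl mul1mx -!scalemxAl !outer_mul (dotC b) ab scale0r scaler0 subr0.
  by rewrite scalerA mulVf // scale1r subrr.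
have mb : (1%:M - P - Q) *m b = 0.
  rewrite !mulmxBl mul1mx -!scalemxAl !outer_mul ab scale0r scaler0 subr0.
  by rewrite scalerA mulVf // scale1r subrr.
rewrite !big_ord_recl big_ord0 addr0 /= !proj_mul !toC_mulmx.
rewrite -!scalemxAl ka kb la lb ma mb.
have -> : vec 0 0 = 0 :> 'cV[C]_d by apply/matrixP => i j; rewrite ord1 vecE !mxE.
have -> : vec (c1 *: a') (c1 *: b') = c1%:C *: vec a' b'.
  apply/matrixP => i j; rewrite ord1 [RHS]mxE !vecE !mxE.
  by apply: complex_ext; rewrite !ReImE /=; ring.
(* The output of [k2] is the target up to the factor [c2 * 'i], whose squared modulus is [1 - t]. *)
have -> : vec (c2 *: - b') (c2 *: a') = (c2%:C * 'i%C) *: vec a' b'.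
  apply/matrixP => i j; rewrite ord1 [RHS]mxE !vecE !mxE.
  by apply: complex_ext; rewrite !ReImE /=; ring.
rewrite !projZ proj0 addr0 -scalerDl [X in X *: _](_ : _ = 1) ?scale1r //.
by apply: complex_ext; rewrite !ReImE /=; [ring: c1t c2t|ring].
Qed.

End Kraus.

(** * Monotonicity of a pure-state measure in the modulus of [bil] *)

Context (M : 'cV[C]_d -> R) (M_measure : pure_imaginarity_measure M).

Lemma pure_phase v (u : C) : pure_state v -> u * Num.conj u = 1 -> M (u *: v) = M v.
Proof.
have [_ _ mono] := M_measure => pv u1.
have puv : pure_state (u *: v).
  by apply/pure_stateE; move/pure_stateE: pv; rewrite sqnZ u1 mul1r.
have id_op : real_operation (fun rho : 'M[C]_d => rho).
  exists 1%N, (fun=> 1%:M); split => [_||rho]; rewrite ?big_ord1.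
  - by rewrite -(map_mx1 (real_complex R)); apply: toC_realmx.
  - by rewrite trmx1 map_mx1 mulmx1.
  - by rewrite trmx1 map_mx1 mul1mx mulmx1.
have pE : proj (u *: v) = proj v by rewrite projZ u1 scale1r.
by apply/eqP; rewrite eq_le !(mono _ _ _ id_op).
Qed.

Lemma pure_vec0 a : pure_state (vec a 0) -> M (vec a 0) = 0.
Proof.
have [_ faith _] := M_measure => pa; apply/faith => //; split; first exact: density_proj.
apply/mxOverP => i j; rewrite projE !vecE !mxE; apply/complex_realP.
by exists (a i 0 * a j 0); apply: complex_ext; rewrite !ReImE /=; ring.
Qed.

Lemma pure_mono_aligned a b a' b' :
  pure_state (vec a b) -> pure_state (vec a' b') ->
  dot a b = 0 -> dot a' b' = 0 ->
  0 <= dot a a - dot b b <= dot a' a' - dot b' b' ->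
  M (vec a' b') <= M (vec a b).
Proof.
have [M0 _ mono] := M_measure => p p' ab ab' /andP[r0 rr'].
(* If [b' = 0] the target is real and [M] vanishes there. Otherwise [|a|^2 >= |b|^2 >= |b'|^2 > 0],
   so the divisions in the Kraus operators are legitimate. *)
have [B0|B0] := eqVneq (dot b' b') 0.
  by move: p' => /[dup] p'; rewrite (dot_eq0 B0) => /pure_vec0 ->; apply: M0.
move/pure_stateE: (p); move/pure_stateE: (p'); rewrite /sqn !re_vec !im_vec => N' N.
have B'0 : 0 < dot b' b' by rewrite lt_def B0 dot_ge0.
have [eps [opeps epsE]] : exists eps : 'M[C]_d -> 'M[C]_d, real_operation eps
    /\ eps (proj (vec a b)) = proj (vec a' b').
  move: r0 rr' N N' B'0; set A := dot a a; set B := dot b b.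
  set A' := dot a' a'; set B' := dot b' b' => r0 rr' N N' B'0.
  (* Here all four squared lengths equal 1/2, and any weight would do. *)
  have [e|ne] := eqVneq (A' - B') 0.
    by apply: (@kraus_exists _ _ _ _ _ _ _ _ 0) => //;
      rewrite -?/A -?/B -?/A' -?/B' ?ler01 ?lexx //; lra.
  have pos : 0 < A' - B' by rewrite lt_def ne /=; lra.
  (* This weight solves [t A' + (1 - t) B' = A]; the other equation follows from
     [A + B = A' + B' = 1]. *)
  apply: (@kraus_exists _ _ _ _ _ _ _ _ ((A - B') / (A' - B'))) => //;
    rewrite -?/A -?/B -?/A' -?/B'.
  - by apply/eqP; lra.
  - by apply/eqP; lra.
  - by rewrite divr_ge0 ?ler_pdivrMr //=; lra.
  - by field.
  - have -> : B = 1 - A by lra.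
    have -> : A' = 1 - B' by lra.
    by field; lra.
by apply: (mono eps) => //.
Qed.

(** Aligning both vectors changes neither [M] nor the moduli, and turns the moduli into differences
    of squared lengths. *)
Lemma pure_mono_bil v w : pure_state v -> pure_state w -> `|bil v| <= `|bil w| -> M w <= M v.
Proof.
move=> pv pw; have [u [u1 ubil udot]] := align v.
have [u' [u1' ubil' udot']] := align w.
rewrite -(pure_phase pv u1) -(pure_phase pw u1') -ubil -ubil' !bilE udot udot' mulr0.
rewrite -[u *: v]vec_re_im -[u' *: w]vec_re_im => /andP[_ /=].
rewrite !re_vec !im_vec => rr'; apply: pure_mono_aligned => //.
- by apply/pure_stateE; rewrite vec_re_im sqnZ u1 mul1r; apply/pure_stateE.
- by apply/pure_stateE; rewrite vec_re_im sqnZ u1' mul1r; apply/pure_stateE.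
- rewrite rr' andbT; have : 0 <= bil (u *: v) by rewrite ubil.
  by rewrite bilE => /andP[].
Qed.

End Transport.

(** * Normalization, bounds on matrix entries, and spectral decomposition *)

Section Normalization.
Context {R : realType} {d : nat}.
Local Notation C := R[i].
Implicit Types (x y z a b : 'cV[R]_d) (v w : 'cV[C]_d).

(** The norm on [R[i]] takes values in [R[i]]; [Re] brings it back to [R]. *)
Definition reality v : R := Re `|bil v|.

Lemma realityE v : `|bil v| = (reality v)%:C.
Proof. by rewrite /reality normc_def. Qed.

Lemma ge_reality v : dot (re v) (re v) - dot (im v) (im v) <= reality v.
Proof.
have : (`|Re (bil v)|)%:C <= (reality v)%:C by rewrite -realityE normc_ge_Re.
by rewrite lecR bilE /=; apply: le_trans; apply: ler_norm.
Qed.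

Definition unitv v : 'cV[C]_d := ((Num.sqrt (sqn v))^-1)%:C *: v.

Lemma mul_conj_real (c : R) : c%:C * Num.conj c%:C = (c ^+ 2)%:C.
Proof. by apply: complex_ext; rewrite !ReImE /=; ring. Qed.

Lemma pure_unitv v : v != 0 -> pure_state (unitv v).
Proof.
move=> v0; apply/pure_stateE; rewrite sqnZ mul_conj_real /= exprVn sqr_sqrtr ?sqn_ge0 //.
by rewrite mulVf //; apply: contra_neq v0; apply: sqn_eq0.
Qed.

Lemma proj_unitv v : proj v = (sqn v)%:C *: proj (unitv v).
Proof.
have [->|v0] := eqVneq v 0; first by rewrite /unitv scaler0 proj0 scaler0.
have N0 : sqn v != 0 by apply: contra_neq v0; apply: sqn_eq0.
rewrite projZ mul_conj_real exprVn sqr_sqrtr ?sqn_ge0 // scalerA -rmorphM /=.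
by rewrite divff // scale1r.
Qed.

Lemma reality_unitv v : v != 0 -> reality (unitv v) = reality v / sqn v.
Proof.
move=> v0; apply: complexI; rewrite -realityE bilZ -rmorphXn exprVn sqr_sqrtr ?sqn_ge0 //.
rewrite normrM realityE ger0_norm; first by rewrite mulrC rmorphM.
by rewrite ler0c invr_ge0 sqn_ge0.
Qed.

Lemma sum_sqn (s : seq 'cV[C]_d) :
  (\sum_(v <- s) sqn v)%:C = \tr (\sum_(v <- s) proj v).
Proof. by rewrite rmorph_sum [RHS]raddf_sum; apply: eq_bigr => v _; rewrite [RHS]sqn_trace. Qed.

(** Real Kraus operators act separately on real and imaginary parts, so this conservation law holds
    for each part; it fixes the sum of [q] over the outputs. *)
Lemma isometry_dot n (k : 'I_n -> 'M[R]_d) x : \sum_j (k j)^T *m k j = 1%:M ->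
  \sum_j dot (k j *m x) (k j *m x) = dot x x.
Proof.
move=> k1; have -> : dot x x = (x^T *m (\sum_j (k j)^T *m k j) *m x) 0 0.
  by rewrite k1 mulmx1.
rewrite mulmx_sumr mulmx_suml summxE; apply: eq_bigr => j _.
by rewrite /dot trmx_mul !mulmxA.
Qed.

(** Taking real parts of a mixture thus replaces each vector by two real ones, which cost nothing in
    the roof. *)
Lemma proj_re_im v :
  proj (vec (re v) 0) + proj (vec (im v) 0) = toC (map_mx (@complex.Re R) (proj v)).
Proof.
apply/matrixP => i j; rewrite [LHS]mxE [RHS]mxE [in RHS]mxE !projE !vecE !mxE.
by apply: complex_ext; rewrite !ReImE /=; ring.
Qed.

Lemma unitv_vec0 a : exists b, unitv (vec a 0) = vec b 0.
Proof.
exists ((Num.sqrt (sqn (vec a 0)))^-1 *: a); rewrite /unitv; move: (_^-1) => c.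
apply/matrixP => i j; rewrite ord1 [LHS]mxE !vecE !mxE.
by apply: complex_ext; rewrite !ReImE /=; ring.
Qed.

Lemma coord2_le_dot a (k l : 'I_d) : k != l -> a k 0 ^+ 2 + a l 0 ^+ 2 <= dot a a.
Proof.
move=> kl; rewrite dotE (bigD1 k) //= (bigD1 l) 1?eq_sym //= -!expr2 addrA lerDl.
by apply: sumr_ge0 => i _; rewrite -expr2 sqr_ge0.
Qed.

(** For an aligned unit vector the squared length of the imaginary part is [(1 - reality v) / 2],
    and the entry is a 2 by 2 determinant of coordinates of the real and imaginary parts. *)
Lemma Im_proj_bound v (k l : 'I_d) : pure_state v -> k != l ->
  Im (proj v k l) ^+ 2 <= (1 - reality v) / 2.
Proof.
move=> pv kl; have [u [u1 ubil _]] := align v; rewrite realityE in ubil.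
have -> : proj v = proj (u *: v) by rewrite projZ u1 scale1r.
have : sqn (u *: v) = 1 by rewrite sqnZ u1 mul1r; apply/pure_stateE.
move: ubil => /(congr1 (@complex.Re R)); rewrite bilE /=.
move: (u *: v) => w wr; rewrite projE /sqn !ReImE.
move: (coord2_le_dot (re w) kl) (coord2_le_dot (im w) kl); rewrite !mxE.
move: (dot_ge0 (im w)); move: wr; move: (dot (re w) (re w)) => A.
move: (dot (im w) (im w)) => B; move: (Re (w k 0)) (Re (w l 0)) => a1 a2.
move: (Im (w k 0)) (Im (w l 0)) => b1 b2 wr B0 hA hB AB.
have -> : (1 - reality v) / 2 = B by lra.
have A1 : A <= 1 by lra.
apply: (@le_trans _ _ ((a1 ^+ 2 + a2 ^+ 2) * (b1 ^+ 2 + b2 ^+ 2))).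
  (* Lagrange's identity: the gap in Cauchy-Schwarz is a square. *)
  by rewrite -subr_ge0 (_ : _ - _ = (a1 * b1 + a2 * b2) ^+ 2) ?sqr_ge0 //; ring.
apply: (@le_trans _ _ (1 * B)); last by rewrite mul1r.
by apply: ler_pM => //; rewrite ?addr_ge0 ?sqr_ge0 //; lra.
Qed.

(** The vectors are eigenvectors scaled by the square roots of their eigenvalues. *)
Lemma density_sum_proj (rho : 'M[C]_d) : density rho ->
  exists s : seq 'cV[C]_d, \sum_(v <- s) proj v = rho.
Proof.
move=> [rhoH rho_ge0 _]; pose P := spectral.spectralmx rho.
pose D := spectral.spectral_diag rho.
have PU : P \is spectral.unitarymx by exact: spectral.spectral_unitarymx.
have PP : P *m P ^t* = 1%:M by apply/spectral.unitarymxP.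
have rhoE : rho = P ^t* *m diag_mx D *m P.
  rewrite -spectral.invmx_unitary //; apply/spectral.orthomx_spectralP.
  exact: spectral.hermitian_normalmx.
(* The eigenvalue is the quadratic form of [rho] at its unit eigenvector, the adjoint of a row of
   [P]. *)
have D_ge0 k : 0 <= D 0 k.
  have := rho_ge0 ((row k P) ^t*); rewrite trmxCK.
  have -> : (row k P *m rho *m (row k P) ^t*) 0 0 = (P *m rho *m P ^t*) k k.
    by rewrite -row_mul !mxE; apply: eq_bigr => j _; rewrite !mxE.
  rewrite rhoE !mulmxA PP mul1mx -mulmxA PP mulmx1.
  by rewrite mxE eqxx mulr1n.
exists [seq sqrtC (D 0 k) *: (row k P) ^t* | k <- enum 'I_d].
rewrite big_map big_enum /= [RHS]rhoE.
apply/matrixP => i j; rewrite summxE [RHS]mxE; apply: eq_bigr => k _.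
rewrite projZ -normCK -normrX sqrtCK ger0_norm // mxE projE.
rewrite mul_mx_diag !mxE conjCK; ring.
Qed.

End Normalization.

(** * Roof values as sums of weights of unnormalized vectors *)

Section Roof.
Context {R : realType} {d : nat}.
Local Notation C := R[i].
Implicit Types (v w : 'cV[C]_d) (s t : seq 'cV[C]_d) (rho : 'M[C]_d).
Context (M : 'cV[C]_d -> R) (M_measure : pure_imaginarity_measure M).

Let M_ge0 v : pure_state v -> 0 <= M v.
Proof. by have [H _ _] := M_measure; apply: H. Qed.

Lemma pure_mono_reality v w : pure_state v -> pure_state w -> reality v <= reality w -> M w <= M v.
Proof. by move=> pv pw vw; apply: (pure_mono_bil M_measure) => //; rewrite !realityE lecR. Qed.

(* The share of [proj v] in the value of a decomposition: working with unnormalized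
   vectors absorbs the probabilities.  At [v = 0] the junk value of [unitv] is harmless. *)
Definition weight v : R := sqn v * M (unitv v).

Lemma sqn0 : sqn (0 : 'cV[C]_d) = 0.
Proof. by rewrite -(scale0r 0) sqnZ mul0r mul0r. Qed.

Lemma weight0 : weight 0 = 0.
Proof. by rewrite /weight sqn0 mul0r. Qed.

Lemma weight_ge0 v : 0 <= weight v.
Proof.
have [->|v0] := eqVneq v 0; first by rewrite weight0.
by rewrite mulr_ge0 ?sqn_ge0 // M_ge0 //; apply: pure_unitv.
Qed.

Lemma weight_vec0 a : weight (vec a 0) = 0.
Proof.
have [->|v0] := eqVneq (vec a 0) 0; first exact: weight0.
have := pure_unitv v0; rewrite /weight; have [b ->] := unitv_vec0 a => pb.
by rewrite (pure_vec0 M_measure pb) mulr0.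
Qed.

(** The squared norms serve as probabilities, summing to the trace. Zero vectors are filtered out
    first, since they cannot be normalized to pure states. *)
Lemma roof_values_sum rho s : \tr rho = 1 -> \sum_(v <- s) proj v = rho ->
  roof_values M rho (\sum_(v <- s) weight v).
Proof.
move=> tr1 sE; pose s' := [seq v <- s | v != 0].
have drop0 (V : nmodType) (f : 'cV[C]_d -> V) :
    f 0 = 0 -> \sum_(v <- s) f v = \sum_(v <- s') f v.
  move=> f0; rewrite big_filter [LHS](bigID (fun v => v != 0)) /= [X in _ + X]big1 ?addr0 //.
  by move=> v /negPn/eqP ->.
have s'0 (i : 'I_(size s')) : tnth (in_tuple s') i != 0.
  by have := mem_tnth i (in_tuple s'); rewrite mem_filter => /andP[].
exists (size s'), (fun i => sqn (tnth (in_tuple s') i)),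
  (fun i => unitv (tnth (in_tuple s') i)).
split; last by rewrite (drop0 _ weight weight0) (big_tnth _ _ s').
split.
- by move=> i; apply: sqn_ge0.
- rewrite -(big_tnth _ _ s' xpredT sqn) -(drop0 _ sqn sqn0); apply: complexI.
  by rewrite sum_sqn sE tr1.
- by move=> i; apply: pure_unitv.
- rewrite -sE (drop0 _ (@proj R d) proj0) (big_tnth _ _ s'); apply: eq_bigr => i _.
  exact: proj_unitv.
Qed.

Lemma weight_scale (p : R) v : 0 <= p -> pure_state v ->
  weight ((Num.sqrt p)%:C *: v) = p * M v.
Proof.
move=> p0 /pure_stateE v1; have [->|pn0] := eqVneq p 0.
  by rewrite sqrtr0 scale0r weight0 mul0r.
rewrite /weight /unitv sqnZ mul_conj_real /= sqr_sqrtr // v1 mulr1 scalerA -rmorphM /=.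
by rewrite mulVf ?scale1r // sqrtr_eq0 -ltNge lt_def pn0.
Qed.

Lemma sum_roof_values rho (r : R) : roof_values M rho r ->
  exists2 s, \sum_(v <- s) proj v = rho & r = \sum_(v <- s) weight v.
Proof.
move=> [n [p [psi [[p0 _ ppsi ->] ->]]]].
exists [seq (Num.sqrt (p i))%:C *: psi i | i <- enum 'I_n].
  rewrite big_map big_enum /=; apply: eq_bigr => i _.
  by rewrite projZ mul_conj_real sqr_sqrtr.
by rewrite big_map big_enum /=; apply: eq_bigr => i _; rewrite weight_scale.
Qed.

Lemma roof_values_neq0 rho : density rho -> (roof_values M rho !=set0)%classic.
Proof.
move=> drho; have [s sE] := density_sum_proj drho.
exists (\sum_(v <- s) weight v); apply: roof_values_sum => //.
by case: drho.
Qed.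

Lemma roof_values_ge0 rho : lbound (roof_values M rho) 0.
Proof.
move=> r /sum_roof_values [s _ ->]; apply: sumr_ge0 => v _; exact: weight_ge0.
Qed.

(** * Pushing a decomposition through a real operation *)

Section Monotone.
Variables (n : nat) (K : 'I_n -> 'M[C]_d).
Hypotheses (K_real : forall j, K j \is a realmx)
  (K_tp : \sum_j (K j) ^t* *m K j = 1%:M).

Lemma weight_kraus v : exists2 t,
  \sum_(w <- t) proj w = \sum_j K j *m proj v *m (K j) ^t*
  & \sum_(w <- t) weight w <= weight v.
Proof.
have [->|v0] := eqVneq v 0.
  exists [::]; rewrite !big_nil ?weight_ge0 // big1 // => j _.
  by rewrite proj0 mulmx0 mul0mx.
have /choice [k kE] : forall j, exists A, K j = toC A by move=> j; apply: realmx_toC.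
have k_tp : \sum_j (k j)^T *m k j = 1%:M.
  apply: toC_inj; rewrite toC1 toC_sum.
  by rewrite -[RHS]K_tp; apply: eq_bigr => j _; rewrite kE toC_adj toC_mul.
have [v' [vP vN vr]] : exists v', [/\ proj v' = proj v, sqn v' = sqn v
    & dot (re v') (re v') - dot (im v') (im v') = reality v].
  have [u [u1 ubil _]] := align v; exists (u *: v); split.
  - by rewrite projZ u1 scale1r.
  - by rewrite sqnZ u1 mul1r.
  - by move: ubil; rewrite realityE bilE => -[].
rewrite -vP.
(* With these coefficients the pooled form is [sqn v * Re (bil w) - reality v * sqn w], the
   homogeneous version of [q] for unnormalized [v]. Its sum over the outputs [K j *m v'] is 0. *)
pose al := sqn v - reality v; pose be := - (sqn v + reality v).
have [|t [tE tq]] := @pool R d al be [seq K j *m v' | j <- enum 'I_n].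
  rewrite big_map big_enum /= big_split /= -!mulr_sumr.
  have kv j : K j *m v' = vec (k j *m re v') (k j *m im v').
    by rewrite kE -toC_mulmx vec_re_im.
  rewrite (eq_bigr (fun j => dot (k j *m re v') (k j *m re v'))); last first.
    by move=> j _; rewrite kv re_vec.
  rewrite [X in _ + _ * X](eq_bigr (fun j => dot (k j *m im v') (k j *m im v'))); last first.
    by move=> j _; rewrite kv im_vec.
  rewrite !isometry_dot // /al /be -vN -vr /sqn.
  by rewrite le_eqVlt; apply/orP; left; apply/eqP; ring.
have tE' : \sum_(w <- t) proj w = \sum_j K j *m proj v' *m (K j) ^t*.
  by rewrite tE big_map big_enum; apply: eq_bigr => j _; rewrite proj_mul.
exists t => //.
(* Trace preservation lets [weight v] be distributed over [t] in proportion to [sqn w], so weights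
   can be compared term by term. *)
have tN : \sum_(w <- t) sqn w = sqn v.
  apply: complexI; rewrite sum_sqn tE' raddf_sum /= -vN -sqn_trace.
  rewrite -[in RHS](mul1mx (proj v')) -K_tp mulmx_suml raddf_sum /=.
  by apply: eq_bigr => j _; rewrite mxtrace_mulC mulmxA.
rewrite /weight -tN mulr_suml big_seq [leRHS]big_seq; apply: ler_sum => w /tq qw.
have [->|w0] := eqVneq w 0; first by rewrite sqn0 !mul0r.
apply: ler_wpM2l; first exact: sqn_ge0.
apply: pure_mono_reality; rewrite ?reality_unitv //; try exact: pure_unitv.
have pos x : x != 0 -> 0 < sqn x.
  by move=> x0; rewrite lt_def sqn_ge0 andbT; apply: contra_neq x0; apply: sqn_eq0.
(* Clearing denominators leaves [reality v * sqn w <= reality w * sqn v], which is [0 <= q w]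
   combined with [Re (bil w) <= reality w]. *)
rewrite ler_pdivrMr ?pos // mulrAC ler_pdivlMr ?pos //.
have := ler_wpM2l (sqn_ge0 v) (ge_reality w); move: qw; rewrite /al /be /sqn.
move: (dot (re w) _) (dot (im w) _) (dot _ _) (dot _ _) => *; lra.
Qed.

Lemma weight_kraus_sum s : exists2 t,
  \sum_(w <- t) proj w = \sum_j K j *m (\sum_(v <- s) proj v) *m (K j) ^t*
  & \sum_(w <- t) weight w <= \sum_(v <- s) weight v.
Proof.
elim: s => [|v s [t tE tw]].
  by exists [::]; rewrite !big_nil // big1 // => j _; rewrite mulmx0 mul0mx.
have [t' tE' tw'] := weight_kraus v; exists (t' ++ t); last first.
  by rewrite big_cat big_cons lerD.
rewrite big_cat /= tE tE' -big_split /=; apply: eq_bigr => j _.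
by rewrite big_cons mulmxDr mulmxDl.
Qed.

End Monotone.

(** Every decomposition of [rho] yields one of [eps rho] of no larger value, so the infima compare
    without being attained. *)
Lemma roof_mono eps rho : real_operation eps -> density rho ->
  convex_roof M (eps rho) <= convex_roof M rho.
Proof.
move=> [n [K [K_real K_tp epsE]]] drho.
apply: lb_le_inf; first exact: roof_values_neq0.
move=> r /sum_roof_values [s sE ->].
have [t tE tw] := weight_kraus_sum K_real K_tp s.
apply: le_trans tw; apply: ge_inf; first by exists 0; apply: roof_values_ge0.
apply: roof_values_sum; last by rewrite tE sE epsE.
rewrite epsE raddf_sum /= (eq_bigr (fun j => \tr ((K j) ^t* *m K j *m rho))).
  by rewrite -raddf_sum -mulmx_suml K_tp mul1mx; case: drho.
by move=> j _; rewrite mxtrace_mulC mulmxA.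
Qed.

(** Splitting each vector of a decomposition into its real and imaginary parts gives the real part
    of [rho], which is [rho] itself, at total weight 0. *)
Lemma roof_real rho : real_state rho -> convex_roof M rho = 0.
Proof.
move=> [drho /mxOverP rho_real]; have [s sE] := density_sum_proj drho.
pose t := flatten [seq [:: vec (re v) 0; vec (im v) 0] | v <- s].
have tw : \sum_(v <- t) weight v = 0.
  rewrite big_flatten big_map big1 // => v _.
  by rewrite big_cons big_seq1 /= !weight_vec0 addr0.
apply: convex_roof_min; last exact: roof_values_ge0.
rewrite -tw; apply: roof_values_sum; first by case: drho.
transitivity (toC (map_mx (@complex.Re R) rho)).
  rewrite -sE; rewrite big_flatten big_map /=.
  transitivity (\sum_(v <- s) toC (map_mx (@complex.Re R) (proj v))).
    by apply: eq_bigr => v _; rewrite big_cons big_seq1 proj_re_im.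
  rewrite -toC_sum; congr toC; apply/matrixP => i j.
  by rewrite [RHS]mxE !summxE Re_sum; apply: eq_bigr => v _; rewrite [LHS]mxE.
by apply/matrixP => i j; rewrite !mxE RRe_real.
Qed.

(** * Strict positivity of the roof on non-real states *)

Lemma pure_gt0 v (k l : 'I_d) : pure_state v -> Im (proj v k l) != 0 -> 0 < M v.
Proof.
move=> pv Im0; have [_ faith _] := M_measure; rewrite lt_def M_ge0 // andbT.
apply: contra_neq Im0 => /faith-/(_ pv)[_ /mxOverP/(_ k l)].
by move=> /complex_realP [x ->].
Qed.

(** A unit vector with more [reality] than a fixed non-real [phi] has an entry of size at most [y];
    any other has [M v >= M phi], so the second term alone is at least 1. Scaling covers all
    vectors. *)
Lemma Im_proj_le (k l : 'I_d) (y : R) : k != l -> 0 < y ->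
  exists2 c : R, 0 < c & forall v, `|Im (proj v k l)| <= y * sqn v + c * weight v.
Proof.
(* The state [phi] will be [e |k> + i b |l>], with [(1 - reality phi) / 2 = b^2]. The cap 1/2 keeps
   [1 - b^2] and [1 - 2 b^2] positive. *)
move=> kl y0; pose b := Num.min y (1 / 2).
have b0 : 0 < b by rewrite lt_min y0 divr_gt0.
have b1 : b <= 1 / 2 by rewrite ge_min lexx orbT.
have b2 : 0 < 1 - b ^+ 2 by nra.
pose e := Num.sqrt (1 - b ^+ 2); have e2 : e ^+ 2 = 1 - b ^+ 2 by rewrite sqr_sqrtr // ltW.
have e0 : 0 < e by rewrite sqrtr_gt0.
pose x : 'cV[R]_d := e *: delta_mx k 0; pose z : 'cV[R]_d := b *: delta_mx l 0.
have dotd i j (f g : R) : dot (f *: delta_mx i 0) (g *: delta_mx j 0) = f * g * (i == j)%:R.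
  rewrite dotE (bigD1 i) //= big1 ?addr0 => [|m mi]; last first.
    by rewrite !mxE (negPf mi) mulr0 mul0r.
  by rewrite !mxE !eqxx !andbT mulr1 mulrA.
pose phi := vec x z.
have phi1 : pure_state phi.
  by apply/pure_stateE; rewrite /sqn re_vec im_vec !dotd !eqxx !mulr1 -!expr2 e2 subrK.
have phir : reality phi = 1 - 2 * b ^+ 2.
  apply: complexI; rewrite -realityE bilE re_vec im_vec !dotd !eqxx (negPf kl).
  rewrite !mulr0 complexr0 -!expr2 !mulr1 e2 ger0_norm ?ler0c; last by nra.
  by congr (_%:C); ring.
have phi0 : 0 < M phi.
  apply: (@pure_gt0 _ k l) => //; rewrite projE !vecE !mxE !eqxx (negPf kl) /=.
  by rewrite !mulr1 mulr0 mul0r addr0 mulrN oppr_eq0 mulf_neq0 ?gt_eqF.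
have unit_case v : pure_state v -> `|Im (proj v k l)| <= y + (M phi)^-1 * M v.
  move=> pv; have := Im_proj_bound pv kl; have [rv|rv] := leP (reality v) (reality phi).
    have Mv := pure_mono_reality pv phi1 rv => Im2.
    have r0 : 0 <= reality v by rewrite -ler0c -realityE normr_ge0.
    have : 1 <= (M phi)^-1 * M v by rewrite mulrC ler_pdivlMr ?mul1r.
    have : `|Im (proj v k l)| <= 1.
      by rewrite -(ler_pXn2r (n := 2)) ?nnegrE ?normr_ge0 // real_normK ?num_real // expr1n; lra.
    lra.
  move=> Im2; apply: (@le_trans _ _ b).
    rewrite -(ler_pXn2r (n := 2)) ?nnegrE ?normr_ge0 ?(ltW b0) // real_normK ?num_real //.
    by apply: le_trans Im2 _; lra.
  apply: (@le_trans _ _ y); first by rewrite ge_min lexx.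
  by rewrite lerDl mulr_ge0 ?invr_ge0 ?(ltW phi0) ?M_ge0.
exists (M phi)^-1; first by rewrite invr_gt0.
move=> v; have [->|v0] := eqVneq v 0.
  by rewrite proj0 mxE weight0 sqn0 !mulr0 addr0 normr0.
rewrite {1}proj_unitv mxE !ReImE /= mul0r addr0 normrM ger0_norm ?sqn_ge0 //.
rewrite /weight mulrCA (mulrC y) -mulrDr; apply: ler_wpM2l; first exact: sqn_ge0.
exact/unit_case/pure_unitv.
Qed.

Lemma roof_eq0_real rho : density rho -> convex_roof M rho = 0 -> real_state rho.
Proof.
move=> drho roof0; split => //; apply/mxOverP => k l; apply/complex_realP.
exists (Re (rho k l)); apply: complex_ext => //=; apply/eqP/negPn/negP => Im0.
have [s0 s0E] := density_sum_proj drho.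
have kl : k != l.
  apply: contra_neq Im0 => ->; rewrite -s0E summxE Im_sum big1 // => v _.
  by rewrite projE !ReImE; ring.
(* Summing the bound with [y / 2] over a decomposition uses up only half of [y]; the other half
   bounds [c] times its value from below, uniformly. *)
pose y := `|Im (rho k l)|; have y0 : 0 < y / 2 by rewrite divr_gt0 // normr_gt0.
have [c c0 cP] := Im_proj_le kl y0.
suff : y / 2 / c <= convex_roof M rho.
  by rewrite roof0 leNgt divr_gt0.
apply: lb_le_inf; first exact: roof_values_neq0.
move=> r /sum_roof_values [s sE ->]; rewrite ler_pdivrMr //.
have sN : \sum_(v <- s) sqn v = 1.
  by apply: complexI; rewrite sum_sqn sE; case: drho.
have : y <= y / 2 * \sum_(v <- s) sqn v + c * \sum_(v <- s) weight v.
  rewrite !mulr_sumr -big_split /=.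
  have {1}-> : y = `|\sum_(v <- s) Im (proj v k l)| by rewrite /y -sE summxE Im_sum.
  apply: le_trans (ler_norm_sum _ _ _) _.
  by apply: ler_sum => v _; apply: cP.
rewrite sN mulrC; lra.
Qed.

End Roof.

Theorem theorem5 (R : realType) (d : nat) (M : 'cV[R[i]]_d -> R)
  (M_measure : pure_imaginarity_measure M)
  (roof_convex : convex_on_states (convex_roof M)) :
  imaginarity_measure (convex_roof M).
Proof.
split => [rho drho|rho drho|eps rho opeps drho].
- apply: lb_le_inf; first exact: roof_values_neq0.
  exact: roof_values_ge0.
- split; [exact: roof_eq0_real | exact: roof_real].
- exact: roof_mono.
Qed.
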